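(* Let $n\ge3$ and $2\le p\le n-1$ be integers. For every $\kappa\in\mathcal P_p$, every $i\in\{1,\dots,n\}$, and every $t\in\mathbb{R}^n$ with $\sum_jS_jt_j=0$, $$Q_i\ge\frac{2S_i}{pH}\Big(\sum_jt_j\Big)^2 .$$ Equality in this inequality (under the constraint $\sum_jS_jt_j=0$) holds only for $t=0$. In particular, $$\frac{H\mathcal Q_i}{S_i}>\frac2p$$ for each fixed $\kappa\in\mathcal P_p\setminus\mathbb{R}\mathbf 1$, while the infimum of $H\mathcal Q_i/S_i$ over these curvature vectors $\kappa\in\mathcal P_p\setminus\mathbb{R}\mathbf 1$ is $2/p$. The constant $2/p$ is optimal over $\mathcal P_p$ (it cannot be replaced in the displayed inequality by a larger constant valid for all $\kappa\in\mathcal P_p$) for every such $n,p$.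
   Context: All indices $i,j$ range over $\{1,\dots,n\}$. $\mathcal I_p=\{I\subset\{1,\dots,n\}:|I|=p\}$; for $\kappa\in\mathbb{R}^n$, $\lambda_I=\sum_{i\in I}\kappa_i$ and $H=\sum_i\kappa_i$; $\mathcal P_p=\{\kappa\in\mathbb{R}^n:\lambda_I>0\text{ for all }I\in\mathcal I_p\}$; $\mathbf 1=(1,\dots,1)$. For $\kappa\in\mathcal P_p$, $S_i=\sum_{I\in\mathcal I_p,\,I\ni i}\lambda_I^{-1}$. For $\kappa\in\mathcal P_p$, $i\in\{1,\dots,n\}$ and $t=(t_1,\dots,t_n)\in\mathbb{R}^n$, $$Q_i=Q_i(\kappa,t)=2\sum_{j\ne i}\ \sum_{\substack{K\subset\{1,\dots,n\}\setminus\{i,j\}\\|K|=p-1}}\frac{t_j^2}{\lambda_{K\cup\{i\}}\lambda_{K\cup\{j\}}}+\sum_{I\in\mathcal I_p}\lambda_I^{-2}\Big(\sum_{j\in I}t_j\Big)^2 .$$ For $\kappa\in\mathcal P_p\setminus\mathbb{R}\mathbf 1$, $\mathcal Q_i=\mathcal Q_i(\kappa)$ denotes the minimum of $Q_i(\kappa,t)$ over all $t\in\mathbb{R}^n$ satisfying $\sum_jt_j=1$ and $\sum_jS_jt_j=0$. *)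

(* Defs.v *)
From mathcomp Require Import all_boot all_order all_algebra.
From mathcomp Require Import all_classical all_reals.

Set Implicit Arguments.
Unset Strict Implicit.
Unset Printing Implicit Defensive.

Import Order.TTheory GRing.Theory Num.Theory.

Local Open Scope classical_set_scope.
Local Open Scope ring_scope.

Section Curvature.
Context {R : realType} {n : nat}.
Implicit Types (p : nat) (kappa t : 'rV[R]_n) (I K : {set 'I_n}) (i j : 'I_n).

Definition lam kappa I : R := \sum_(i in I) kappa 0 i.

Definition meanH kappa : R := \sum_i kappa 0 i.

Definition cone p : set 'rV[R]_n :=
  [set kappa | forall I, #|I| = p -> 0 < lam kappa I].

(* The line of vectors with all coordinates equal. *)
Definition umbilic : set 'rV[R]_n := range (fun c : R => const_mx c).

Definition Scoef p kappa i : R :=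
  \sum_(I : {set 'I_n} | (#|I| == p) && (i \in I)) (lam kappa I)^-1.

Definition Qform p kappa i t : R :=
  2 * (\sum_(j | j != i)
         \sum_(K : {set 'I_n} | [&& #|K| == p.-1, i \notin K & j \notin K])
           (t 0 j) ^+ 2 / (lam kappa (i |: K)%SET * lam kappa (j |: K)%SET))
  + \sum_(I : {set 'I_n} | #|I| == p)
      (lam kappa I) ^- 2 * (\sum_(j in I) t 0 j) ^+ 2.

Definition feasible p kappa : set 'rV[R]_n :=
  [set t | \sum_j t 0 j = 1 /\ \sum_j Scoef p kappa j * t 0 j = 0].

(* Least element of A, and 0 when A has none: unlike [inf], this takes a
   positive value only if that value is attained. *)
Definition minimum (A : set R) : R := xget 0 (A `&` lbound A).

Definition minQ p kappa i : R := minimum (Qform p kappa i @` feasible p kappa).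

End Curvature.

(* Main.v *)
Require Import Defs.
From mathcomp Require Import all_boot all_order all_algebra.
From mathcomp Require Import all_classical all_reals all_analysis.
From mathcomp Require Import ring lra.

Set Implicit Arguments.
Unset Strict Implicit.

Import Order.TTheory GRing.Theory Num.Theory numFieldNormedType.Exports.

Local Open Scope classical_set_scope.
Local Open Scope ring_scope.

(* Put x = kappa_i, M = 'C(n-1, p-1), T = \sum_j t_j and u_I = t_I / lam_I, so
   that the constraint reads \sum_I u_I = 0.  For every c,
     S_i T = \sum_(I containing i) \sum_(j outside I) t_j / lam_I
             + \sum_I ([i in I] - c) u_I,
   and AM-GM against the squares in Q_i, with I' = I - i + j, gives
   Q_i >= 2 tau S_i T - tau^2 C for every tau, where
     2 C = \sum_(I, j) lam_I' / lam_I + 2 \sum_I ([i in I] - c)^2.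
   The first sum is (H - (n-p) x) S_i + M (n-p-1); with c = p/n the second one
   is M (1 - p/n), and the harmonic-arithmetic mean inequality for the lam_I
   with i in I yields 2 C <= p H S_i - 2 M p/n.  Choosing tau = 2T / (p H)
   leaves a strictly positive multiple of T^2 as a surplus.
   Optimality is seen at kappa_i = e - (p-1), all other kappa_j = 1, e -> 0. *)

(** * Counting subsets of fixed size and reindexing sums over them *)

Lemma card_draws_notin {T : finType} (i : T) (k : nat) :
  #|[set I : {set T} | (#|I| == k) && (i \notin I)]%SET| = 'C(#|T|.-1, k).
Proof.
rewrite -(cardsC1 i) -cards_draws; apply: eq_card => I.
by rewrite !inE finset.subsetC finset.sub1set !inE andbC.
Qed.

(** Adding [i] is a bijection from [k]-subsets avoiding [i] onto [k.+1]-subsets containing it.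
    Testing [P] on [I :\ i] lets extra conditions, such as avoiding a second index, pass through
    it. *)
Lemma big_setU1_draws {V : nmodType} {T : finType} (i : T) (k : nat)
    (P : pred {set T}) (F : {set T} -> V) :
  \sum_(I : {set T} | [&& #|I| == k.+1, i \in I & P (I :\ i)%SET]) F I
  = \sum_(K : {set T} | [&& #|K| == k, i \notin K & P K]) F (i |: K)%SET.
Proof.
rewrite (reindex_onto (fun K => i |: K)%SET (fun I => I :\ i)%SET) /=;
  last by move=> I /and3P[_ iI _]; rewrite finset.setD1K.
apply: eq_bigl => K; rewrite cardsU1 finset.setU11.
case: (boolP (i \in K)) => iK /=; last by rewrite finset.setU1K // eqxx !andbT.
(* If [i] already lies in [K], removing [i] from [i |: K] cannot give [K] back. *)
rewrite andbF; apply/negbTE; rewrite negb_and; apply/orP; right.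
by apply: contraTneq iK => <-; rewrite !inE eqxx.
Qed.

Lemma card_draws_in {T : finType} (i : T) (k : nat) :
  #|[set I : {set T} | (#|I| == k.+1) && (i \in I)]%SET| = 'C(#|T|.-1, k).
Proof.
rewrite -(card_draws_notin i) -!sum1_card.
transitivity (\sum_(I : {set T} | [&& #|I| == k.+1, i \in I & true]) 1)%N.
  by apply: eq_bigl => I; rewrite inE andbT.
rewrite (big_setU1_draws i k xpredT).
by apply: eq_bigl => K; rewrite inE andbT.
Qed.

Lemma card_draws_in_notin {T : finType} (i j : T) (k : nat) : j != i ->
  #|[set I : {set T} | [&& #|I| == k.+1, i \in I & j \notin I]]%SET|
  = 'C(#|T|.-2, k).
Proof.
move=> ji.
have -> : #|T|.-2 = #|[set~ i] :\ j|%SET.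
  by have := cardsD1 j [set~ i]%SET; rewrite !inE ji cardsC1 => ->.
rewrite -cards_draws -!sum1_card.
transitivity (\sum_(I : {set T} |
  [&& #|I| == k.+1, i \in I & j \notin (I :\ i)%SET]) 1)%N.
  by apply: eq_bigl => I; rewrite !inE ji.
rewrite (big_setU1_draws i k (fun I => j \notin I)); apply: eq_bigl => K.
by rewrite inE subsetD1 finset.subsetC finset.sub1set !inE andbC -andbA.
Qed.

(* Pairs (j, K) in the first sum of Q_i correspond to pairs (I, j) with
   i in I and j outside I, through I = K + i. *)
Lemma exchange_pairs {V : nmodType} {T : finType} (p : nat) (i : T)
    (F : T -> {set T} -> V) :
  \sum_(j | j != i)
    \sum_(K : {set T} | [&& #|K| == p, i \notin K & j \notin K]) F j K
  = \sum_(I : {set T} | (#|I| == p.+1) && (i \in I))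
      \sum_(j | j \notin I) F j (I :\ i)%SET.
Proof.
rewrite (exchange_big_dep (fun K : {set T} => (#|K| == p) && (i \notin K)));
  last by move=> j K _ /and3P[-> ->].
transitivity (\sum_(I : {set T} | [&& #|I| == p.+1, i \in I & true])
  \sum_(j | j \notin I) F j (I :\ i)%SET); last first.
  by apply: eq_bigl => I; rewrite andbT.
rewrite (big_setU1_draws i p xpredT).
apply: eq_big => [K|K /andP[cK iK]]; first by rewrite andbT.
by apply: eq_big => [j|j _]; rewrite ?finset.setU1K // !inE cK iK /= negb_or.
Qed.

(** * Elementary inequalities and continuity of finite sums *)

(** Nonemptiness of [P] is phrased as a positive sum of ones, the form in which the binomial counts
    deliver it. *)
Lemma sumr_gt0_cond {R : realFieldType} {T : finType} (P : pred T)
    (f : T -> R) :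
  (forall I, P I -> 0 < f I) -> 0 < \sum_(I | P I) (1 : R) ->
  0 < \sum_(I | P I) f I.
Proof.
move=> f0; case: (pickP P) => [I PI _|P0]; last by rewrite big_pred0 ?ltxx.
rewrite (bigD1 I) //= ltr_wpDr ?f0 // sumr_ge0 // => J /andP[PJ _].
exact/ltW/f0.
Qed.

(** Harmonic-arithmetic mean inequality: bound each [(f I)^-1] below by the tangent line of the
    inverse at the mean [m / c], then sum. *)
Lemma sqr_sum1_le {R : realFieldType} {T : finType} (P : pred T) (f : T -> R) :
  (forall I, P I -> 0 < f I) ->
  (\sum_(I | P I) 1) ^+ 2 <= (\sum_(I | P I) (f I)^-1) * (\sum_(I | P I) f I).
Proof.
move=> f0; set c := \sum_(I | P I) 1.
have c0 : 0 <= c by rewrite sumr_ge0.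
have [c1|] := ltP 0 c; last first.
  move=> c1; have -> : c = 0 by apply/le_anti/andP.
  by rewrite expr0n mulr_ge0 // sumr_ge0 // => I /f0 /ltW //; rewrite invr_ge0.
have m0 : 0 < \sum_(I | P I) f I by exact: sumr_gt0_cond.
set m := \sum_(I | P I) f I in m0 *.
suff : \sum_(I | P I) (2 * (c / m) * 1 - f I * (c / m) ^+ 2)
       <= \sum_(I | P I) (f I)^-1.
  rewrite sumrB -mulr_sumr -mulr_suml -/c -/m => h.
  rewrite -ler_pdivrMr //; apply: le_trans h; rewrite le_eqVlt; apply/orP; left.
  by apply/eqP; field; rewrite gt_eqF.
apply: ler_sum => I /f0 fI; rewrite -subr_ge0.
have -> : (f I)^-1 - (2 * (c / m) * 1 - f I * (c / m) ^+ 2)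
          = (f I)^-1 * (1 - f I * (c / m)) ^+ 2.
  by field; rewrite !gt_eqF.
by rewrite mulr_ge0 ?sqr_ge0 // invr_ge0 ltW.
Qed.

Lemma continuous_sum {R : realType} {T : topologicalType} {I : Type}
    (r : seq I) (P : pred I) (F : I -> T -> R) :
  (forall j, P j -> continuous (F j)) ->
  continuous (fun t => \sum_(j <- r | P j) F j t).
Proof. by apply: continuous_big; exact: add_continuous. Qed.

(** * Double counting over [p]-subsets *)

Section Estimates.
Context {R : realType} {n p : nat}.
Implicit Types (k t : 'rV[R]_n) (I K : {set 'I_n}) (i j : 'I_n).
Context (p0 : (0 < p)%N) (pn : (p < n)%N).

Local Notation M := ('C(n.-1, p.-1)%:R : R).

(** Turns the constraint into the vanishing of the sum of the u_I. *)
Lemma sum_Scoef k t :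
  \sum_j Scoef p k j * t 0 j
  = \sum_(I : {set 'I_n} | #|I| == p) (\sum_(j in I) t 0 j) / lam k I.
Proof.
under eq_bigr do rewrite /Scoef big_distrl.
rewrite (exchange_big_dep (fun I => #|I| == p)) /=;
  last by move=> j I _ /andP[].
apply: eq_bigr => I cI; rewrite big_distrl /=.
by apply: eq_big => [j|j _]; rewrite ?cI // mulrC.
Qed.

Lemma sum_draws_in i : \sum_(I : {set 'I_n} | (#|I| == p) && (i \in I)) 1 = M.
Proof.
have := card_draws_in i p.-1; rewrite prednK // card_ord => <-.
by rewrite -sum1_card natr_sum; apply: eq_bigl => I; rewrite inE.
Qed.

(** The count is 'C(n-2, p-1); the factor n-1 avoids a quotient of binomials. *)
Lemma sum_draws_in_notin i j : j != i ->
  n.-1%:R * (\sum_(I : {set 'I_n} | [&& #|I| == p, i \in I & j \notin I]) 1)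
  = (n - p)%:R * M.
Proof.
move=> ji; have := card_draws_in_notin p.-1 ji.
rewrite prednK // card_ord => e.
have -> : (n - p = n.-1 - p.-1)%N by case: n p p0 pn => // n' [].
rewrite -natrM -mul_bin_down natrM -e; congr (_ * _).
by rewrite -sum1_card natr_sum; apply: eq_bigl => I; rewrite inE.
Qed.

Lemma sum_draws : p%:R * (\sum_(I : {set 'I_n} | #|I| == p) 1) = n%:R * M.
Proof.
rewrite -natrM mul_bin_diag prednK // natrM; congr (_ * _).
have := card_draws 'I_n p; rewrite card_ord => <-.
by rewrite -sum1_card natr_sum; apply: eq_bigl => I; rewrite inE.
Qed.

Lemma bin_gt0R : 0 < M.
Proof.
by rewrite ltr0n bin_gt0; case: n p p0 pn => // n' [] // p' _ /= /ltnW.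
Qed.

Lemma sum_lam k : \sum_(I : {set 'I_n} | #|I| == p) lam k I = M * meanH k.
Proof.
rewrite (exchange_big_dep predT) //= /meanH mulr_sumr; apply: eq_bigr => j _.
by rewrite -(sum_draws_in j) mulr_suml; apply: eq_bigr => I _; rewrite mul1r.
Qed.

(** Each lam_I is H minus the sum over the complement of I, and every j other than i is missed
    equally often by the subsets containing i. *)
Lemma sum_lam_in k i :
  n.-1%:R * (\sum_(I : {set 'I_n} | (#|I| == p) && (i \in I)) lam k I)
  = M * (p.-1%:R * meanH k + (n - p)%:R * k 0 i).
Proof.
have e I : lam k I = meanH k - \sum_(j | j \notin I) k 0 j.
  by rewrite /meanH (bigID (mem I)) /= addrK.
under eq_bigr do rewrite e -[meanH k]mul1r.
rewrite sumrB -mulr_suml sum_draws_in mulrBr.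
have -> : n.-1%:R * (\sum_(I : {set 'I_n} | (#|I| == p) && (i \in I))
                       \sum_(j | j \notin I) k 0 j)
          = (n - p)%:R * M * (meanH k - k 0 i).
  rewrite (exchange_big_dep (fun j => j != i)) /=; last first.
    by move=> I j /andP[_ iI]; apply: contraNneq => ->.
  have -> : meanH k - k 0 i = \sum_(j | j != i) k 0 j.
    by rewrite /meanH (bigD1 i) //= addrAC subrr add0r.
  rewrite !mulr_sumr; apply: eq_bigr => j ji.
  rewrite -(sum_draws_in_notin ji) -mulrA; congr (_ * _).
  rewrite mulr_suml; apply: eq_big => [I|I _]; last by rewrite mul1r.
  by rewrite andbA.
have -> : n.-1%:R = (n - p)%:R + p.-1%:R :> R.
  by rewrite -natrD; congr (_%:R); case: n p p0 pn => // n' [] //= p' _ h;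
     rewrite subSS subnK // ltnW.
ring.
Qed.

(** * The lower bound for Q_i on the cone *)

Section Cone.
Context (k : 'rV[R]_n) (ck : cone p k).
Let lam0 I : #|I| == p -> 0 < lam k I. Proof. by move=> /eqP/ck. Qed.

Lemma meanH_gt0 : 0 < meanH k.
Proof.
have M0 := bin_gt0R; rewrite -(pmulr_rgt0 _ M0) -sum_lam.
apply: sumr_gt0_cond => //.
have n0 : 0 < n%:R :> R by rewrite ltr0n (leq_trans _ pn).
have := mulr_gt0 n0 M0; rewrite -sum_draws pmulr_rgt0 //.
by rewrite ltr0n.
Qed.

Lemma Scoef_gt0 i : 0 < Scoef p k i.
Proof.
apply: sumr_gt0_cond; last by rewrite sum_draws_in bin_gt0R.
by move=> I /andP[/lam0 h _]; rewrite invr_gt0.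
Qed.

(** The harmonic-arithmetic mean inequality for the lam_I with i in I, with one factor [M]
    cancelled. *)
Lemma Scoef_lower i :
  M * n.-1%:R <= Scoef p k i * (p.-1%:R * meanH k + (n - p)%:R * k 0 i).
Proof.
have := @sqr_sum1_le R _ (fun I => (#|I| == p) && (i \in I)) (lam k).
rewrite sum_draws_in => /(_ _)/(ler_wpM2l (ler0n R n.-1)) h.
rewrite -(ler_pM2l bin_gt0R) [leRHS]mulrCA -sum_lam_in [leRHS]mulrCA.
apply: le_trans (h _); first by rewrite mulrA -expr2 mulrC.
by move=> I /andP[/lam0].
Qed.

(** For fixed I, the swapped sums add up to H - lam_I + (n-p)(lam_I - x), where x = kappa_i;
    dividing by lam_I leaves a multiple of 1 / lam_I and a constant. *)
Lemma sum_ratio i :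
  \sum_(I : {set 'I_n} | (#|I| == p) && (i \in I))
    \sum_(j | j \notin I) lam k (j |: (I :\ i))%SET / lam k I
  = (meanH k - (n - p)%:R * k 0 i) * Scoef p k i + M * ((n - p)%:R - 1).
Proof.
rewrite -(sum_draws_in i) /Scoef mulr_sumr mulr_suml -big_split /=.
apply: eq_bigr => I /andP[cI iI]; have := lam0 cI => l0.
rewrite -mulr_suml.
have e1 : lam k I = k 0 i + lam k (I :\ i)%SET by rewrite /lam (big_setD1 i).
have -> : \sum_(j | j \notin I) lam k (j |: (I :\ i))%SET
          = \sum_(j | j \notin I) (k 0 j + (lam k I - k 0 i) * 1).
  apply: eq_bigr => j jI; rewrite /lam big_setU1 ?inE ?(negPf jI) ?andbF //=.
  by rewrite [\sum_(j in I) _]e1 mulr1 addrAC subrr add0r.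
rewrite big_split /= -mulr_sumr.
have -> : \sum_(j | j \notin I) k 0 j = meanH k - lam k I.
  by rewrite /meanH /lam [in RHS](bigID (mem I)) /= addrAC subrr add0r.
have -> : \sum_(j | j \notin I) 1 = (n - p)%:R :> R.
  have <- : #|~: I|%SET = (n - p)%N.
    by rewrite cardsCs finset.setCK card_ord (eqP cI).
  rewrite -sum1_card natr_sum.
  by apply: eq_bigl => j; rewrite inE.
by field; rewrite gt_eqF.
Qed.

Lemma QformE i t :
  Qform p k i t
  = 2 * (\sum_(I : {set 'I_n} | (#|I| == p) && (i \in I))
           \sum_(j | j \notin I)
             t 0 j ^+ 2 / (lam k I * lam k (j |: (I :\ i))%SET))
    + \sum_(I : {set 'I_n} | #|I| == p) ((\sum_(j in I) t 0 j) / lam k I) ^+ 2.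
Proof.
rewrite /Qform exchange_pairs prednK //; congr (2 * _ + _).
  by apply: eq_bigr => I /andP[_ iI]; under eq_bigr do rewrite finset.setD1K //.
by apply: eq_bigr => I _; rewrite mulrC -exprVn -exprMn.
Qed.

Lemma sum_outside i t :
  \sum_(I : {set 'I_n} | (#|I| == p) && (i \in I))
    \sum_(j | j \notin I) t 0 j / lam k I
  = Scoef p k i * (\sum_j t 0 j)
    - \sum_(I : {set 'I_n} | (#|I| == p) && (i \in I))
        (\sum_(j in I) t 0 j) / lam k I.
Proof.
rewrite /Scoef mulr_suml -sumrB; apply: eq_bigr => I _.
by rewrite -mulr_suml [in RHS](bigID (mem I)) /=; ring.
Qed.

Lemma lam_swap_gt0 (i j : 'I_n) (I : {set 'I_n}) :
  #|I| == p -> i \in I -> j \notin I -> 0 < lam k (j |: (I :\ i))%SET.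
Proof.
move=> cI iI jI; apply: lam0; rewrite cardsU1 !inE (negPf jI) andbF /=.
by rewrite -(eqP cI) (cardsD1 i I) iI.
Qed.

(** The second term on the left is the surplus; it is kept explicit because both strictness and the
    equality case rest on it. *)
Lemma Qform_lower i t : (1 < p)%N -> \sum_j Scoef p k j * t 0 j = 0 ->
  2 * Scoef p k i / (p%:R * meanH k) * (\sum_j t 0 j) ^+ 2
  + 4 * M / (n%:R * p%:R * meanH k ^+ 2) * (\sum_j t 0 j) ^+ 2
  <= Qform p k i t.
Proof.
move=> p1 tS; rewrite QformE; set T := \sum_j t 0 j.
have H0 := meanH_gt0; set H := meanH k in H0 *.
have M0 := bin_gt0R.
have n0 : 0 < n%:R :> R by rewrite ltr0n (leq_trans _ pn).
have p0R : 0 < p%:R :> R by rewrite ltr0n.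
set s := Scoef p k i; set x := k 0 i.
(* [tau] maximizes 2 tau s T - tau^2 p H s / 2, and [c] is the proportion of [p]-subsets containing
   [i]. *)
set tau := 2 * T / (p%:R * H); set c : R := p%:R / n%:R.
set u : {set 'I_n} -> R := fun I => (\sum_(j in I) t 0 j) / lam k I.
set U := \sum_(I : {set 'I_n} | (#|I| == p) && (i \in I)) u I.
have u0 : \sum_(I : {set 'I_n} | #|I| == p) u I = 0 by rewrite -sum_Scoef.
have outside : 2 * tau * (s * T - U)
      - tau ^+ 2 / 2 * ((H - (n - p)%:R * x) * s + M * ((n - p)%:R - 1))
    <= 2 * (\sum_(I : {set 'I_n} | (#|I| == p) && (i \in I))
           \sum_(j | j \notin I)
             t 0 j ^+ 2 / (lam k I * lam k (j |: (I :\ i))%SET)).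
  rewrite -sum_ratio -sum_outside !mulr_sumr -sumrB.
  apply: ler_sum => I /andP[cI iI]; rewrite !mulr_sumr -sumrB.
  apply: ler_sum => j jI; have l0 := lam0 cI; have l1 := lam_swap_gt0 cI iI jI.
  rewrite -subr_ge0; set a := lam k I in l0 *; set b := lam k _ in l1 *.
  (* AM-GM for one pair, as a completed square. *)
  have -> : 2 * (t 0 j ^+ 2 / (a * b)) -
            (2 * tau * (t 0 j / a) - tau ^+ 2 / 2 * (b / a))
            = 2 * (t 0 j - tau * b / 2) ^+ 2 / (a * b).
    by field; rewrite !gt_eqF.
  by apply: divr_ge0; rewrite mulr_ge0 ?sqr_ge0 // ltW.
have inside : 2 * tau * U - tau ^+ 2 * (M - c * M)
    <= \sum_(I : {set 'I_n} | #|I| == p) u I ^+ 2.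
  set b : {set 'I_n} -> R := fun I => (i \in I)%:R.
  (* By [u0], shifting the indicator [b] by a constant changes nothing; its mean [c] gives the least
     sum of squares. *)
  have -> : U = \sum_(I : {set 'I_n} | #|I| == p) (b I - c) * u I.
    under eq_bigr do rewrite mulrBl; rewrite sumrB -mulr_sumr u0 mulr0 subr0.
    rewrite /U big_mkcondr; apply: eq_bigr => I _.
    by rewrite /b; case: (i \in I); rewrite ?mul1r ?mul0r.
  have -> : M - c * M = \sum_(I : {set 'I_n} | #|I| == p) (b I - c) ^+ 2.
    have -> : \sum_(I : {set 'I_n} | #|I| == p) (b I - c) ^+ 2 =
      \sum_(I : {set 'I_n} | #|I| == p) ((1 - 2 * c) * b I + c ^+ 2 * 1).
      apply: eq_bigr => I _; rewrite /b; case: (i \in I) => /=; ring.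
    rewrite big_split /= -!mulr_sumr.
    have -> : \sum_(I : {set 'I_n} | #|I| == p) b I = M.
      rewrite -(sum_draws_in i) big_mkcondr; apply: eq_bigr => I _.
      by rewrite /b; case: (i \in I).
    have -> : \sum_(I : {set 'I_n} | #|I| == p) 1 = n%:R * M / p%:R :> R.
      by rewrite -sum_draws mulrAC mulfV ?mul1r // gt_eqF.
    by rewrite /c; field; rewrite !gt_eqF.
  rewrite !mulr_sumr -sumrB; apply: ler_sum => I _; rewrite -subr_ge0.
  have -> : u I ^+ 2 - (2 * tau * ((b I - c) * u I) - tau ^+ 2 * (b I - c) ^+ 2)
            = (u I - tau * (b I - c)) ^+ 2 by ring.
  exact: sqr_ge0.
apply: le_trans (lerD outside inside).
have low := Scoef_lower i; rewrite -/s -/H -/x in low.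
have tau2 : 0 <= tau ^+ 2 / 2 by rewrite divr_ge0 ?sqr_ge0.
have p2 : 0 <= (p%:R - 2) * M by rewrite mulr_ge0 ?subr_ge0 ?ler_nat // ltW.
have n1 : n.-1%:R = n%:R - 1 :> R by rewrite -subn1 natrB // (leq_trans _ pn).
have pm1 : p.-1%:R = p%:R - 1 :> R by rewrite -subn1 natrB.
have nmp : (n - p)%:R = n%:R - p%:R :> R by rewrite natrB // ltnW.
(* Once 2 c M cancels, this asks for [low] with n-p+1 in place of n-1; the slack is (p-2) M,
   nonnegative since p >= 2. *)
have key : (H - (n - p)%:R * x) * s + M * ((n - p)%:R - 1) + 2 * (M - c * M)
           <= p%:R * H * s - 2 * c * M.
  move: low p2; rewrite n1 pm1 nmp => low p2; lra.
have := ler_wpM2l tau2 key; set L := (H - _) * s + _ => h.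
have -> : 2 * s / (p%:R * H) * T ^+ 2 + 4 * M / (n%:R * p%:R * H ^+ 2) * T ^+ 2
          = 2 * tau * (s * T) - tau ^+ 2 / 2 * (p%:R * H * s - 2 * c * M).
  by rewrite /tau /c; field; rewrite !gt_eqF.
lra.
Qed.

(** * Coercivity of Q_i and solvability of the constraints *)

(** Half the coefficient of t_j^2 in the first sum of Q_i; [Scoef_sub] shows that it also relates
    S_i - S_j to kappa_j - kappa_i. *)
Definition pair_weight (i j : 'I_n) : R :=
  \sum_(K : {set 'I_n} | [&& #|K| == p.-1, i \notin K & j \notin K])
    (lam k (i |: K)%SET * lam k (j |: K)%SET)^-1.

Lemma lam_setU1_gt0 (i : 'I_n) (K : {set 'I_n}) :
  #|K| == p.-1 -> i \notin K -> 0 < lam k (i |: K)%SET.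
Proof.
by move=> /eqP cK iK; apply: lam0; rewrite cardsU1 iK cK add1n prednK.
Qed.

Lemma pair_weight_gt0 i j : j != i -> 0 < pair_weight i j.
Proof.
move=> ji; apply: sumr_gt0_cond.
  move=> K /and3P[cK iK jK].
  by rewrite invr_gt0 mulr_gt0 // lam_setU1_gt0.
have M0 : 0 < 'C(n.-1, p.-1)%:R :> R by exact: bin_gt0R.
have n1 : 0 < n.-1%:R :> R.
  by rewrite ltr0n; case: n p p0 pn => [|[|]] // [].
have np : 0 < (n - p)%:R :> R by rewrite ltr0n subn_gt0.
have := mulr_gt0 np M0; rewrite -(sum_draws_in_notin ji) pmulr_rgt0 //.
suff -> : \sum_(I : {set 'I_n} | [&& #|I| == p, i \in I & j \notin I]) 1
  = \sum_(K : {set 'I_n} | [&& #|K| == p.-1, i \notin K & j \notin K]) 1 :> R.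
  by [].
rewrite -(big_setU1_draws i p.-1 (fun K => j \notin K) (fun=> 1)) prednK //.
by apply: eq_bigl => I; rewrite !inE ji.
Qed.

(** Subsets containing both indices cancel; the others pair up as K + i and K + j, whose lam differ
    by kappa_j - kappa_i. *)
Lemma Scoef_sub i j : j != i ->
  Scoef p k i - Scoef p k j = (k 0 j - k 0 i) * pair_weight i j.
Proof.
have split_sum (a b : 'I_n) : b != a -> Scoef p k a =
    \sum_(I : {set 'I_n} | [&& #|I| == p, a \in I & b \in I]) (lam k I)^-1
    + \sum_(K : {set 'I_n} | [&& #|K| == p.-1, a \notin K & b \notin K])
        (lam k (a |: K)%SET)^-1.
  move=> ba; rewrite /Scoef (bigID (fun I : {set 'I_n} => b \in I)) /=.
  congr (_ + _); first by apply: eq_bigl => I; rewrite andbA.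
  rewrite -(big_setU1_draws a p.-1 (fun K => b \notin K)
             (fun I => (lam k I)^-1)) prednK //.
  by apply: eq_bigl => I; rewrite !inE ba andbA.
move=> ji; rewrite (split_sum i j ji) (split_sum j i); last by rewrite eq_sym.
under [X in _ + _ - (X + _)]eq_bigl do rewrite [(j \in _) && _]andbC.
under [X in _ + _ - (_ + X)]eq_bigl do rewrite [(j \notin _) && _]andbC.
rewrite opprD addrACA subrr add0r -sumrB mulr_sumr.
apply: eq_bigr => K /and3P[cK iK jK].
have l1 := lam_setU1_gt0 cK iK; have l2 := lam_setU1_gt0 cK jK.
have e (a : 'I_n) : a \notin K -> lam k (a |: K)%SET = k 0 a + lam k K.
  by move=> aK; rewrite /lam big_setU1.
rewrite !e // in l1 l2 *; field; rewrite !gt_eqF //.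
Qed.

(** All discarded terms are squares with nonnegative coefficients. This controls every coordinate
    except t_i, which is recovered from the sum of t. *)
Lemma Qform_ge_weight i j (t : 'rV[R]_n) : j != i ->
  2 * pair_weight i j * t 0 j ^+ 2 <= Qform p k i t.
Proof.
move=> ji; rewrite /Qform (bigD1 j) //= mulrDr -addrA.
have -> : 2 * pair_weight i j * t 0 j ^+ 2 = 2 * (
  \sum_(K : {set 'I_n} | [&& #|K| == p.-1, i \notin K & j \notin K])
    t 0 j ^+ 2 / (lam k (i |: K)%SET * lam k (j |: K)%SET)).
  by rewrite -mulr_sumr -mulrA [pair_weight _ _ * _]mulrC.
rewrite lerDl addr_ge0 ?mulr_ge0 ?sumr_ge0 // => [l _|I _].
  apply: sumr_ge0 => K /and3P[cK iK lK].
  by rewrite divr_ge0 ?sqr_ge0 // mulr_ge0 // ltW // lam_setU1_gt0.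
by rewrite mulr_ge0 ?sqr_ge0 // -exprVn sqr_ge0.
Qed.

Lemma Qform_le0 i (t : 'rV[R]_n) :
  \sum_j t 0 j = 0 -> Qform p k i t <= 0 -> t = 0.
Proof.
move=> t1 Qt.
have tj j : j != i -> t 0 j = 0.
  move=> ji; have w0 := pair_weight_gt0 ji.
  have := le_trans (Qform_ge_weight t ji) Qt.
  by rewrite pmulr_rle0 ?mulr_gt0 // real_exprn_even_le0 ?num_real //= => /eqP.
apply/rowP => j; rewrite mxE; have [->|/tj //] := eqVneq j i.
by move: t1; rewrite (bigD1 i) //= big1 ?addr0.
Qed.

(** The two constraints are compatible as soon as two of the S_j differ; if all agree, [Scoef_sub]
    makes all coordinates of [k] equal. *)
Lemma feasible_nonempty : ~ umbilic k -> feasible p k !=set0.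
Proof.
move=> nu.
have n0 : (0 < n)%N by exact: leq_trans pn.
pose a := Ordinal n0.
have [b Sab] : exists b, Scoef p k b != Scoef p k a.
  apply: contrapT => all_eq; apply: nu; exists (k 0 a) => //.
  apply/rowP => b; rewrite mxE; have [->//|ba] := eqVneq b a.
  have /eqP : Scoef p k a - Scoef p k b = 0.
    apply/eqP; rewrite subr_eq0 eq_sym; apply: contraPT isT => h _.
    by apply: all_eq; exists b.
  rewrite Scoef_sub // mulf_eq0 (gt_eqF (pair_weight_gt0 ba)) orbF subr_eq0.
  by move=> /eqP.
have d0 : Scoef p k b - Scoef p k a != 0 by rewrite subr_eq0.
have dsum (f : 'I_n -> R) (x y : R) :
    \sum_j f j * (x *: delta_mx 0 a + y *: delta_mx 0 b : 'rV[R]_n) 0 j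
    = f a * x + f b * y.
  under eq_bigr do rewrite !mxE eqxx /= mulrDr !mulrA.
  rewrite big_split /=; congr (_ + _).
    rewrite (bigD1 a) //= ?eqxx mulr1 big1 ?addr0 // => j /negPf ->.
    by rewrite mulr0.
  rewrite (bigD1 b) //= ?eqxx mulr1 big1 ?addr0 // => j /negPf ->.
  by rewrite mulr0.
(* The solution of x + y = 1 and S_a x + S_b y = 0, supported on [a] and [b]. *)
exists ((Scoef p k b / (Scoef p k b - Scoef p k a)) *: delta_mx 0 a
        - (Scoef p k a / (Scoef p k b - Scoef p k a)) *: delta_mx 0 b).
rewrite -scaleNr; split; last by rewrite dsum; field.
under eq_bigr do rewrite -[_ 0 _]mul1r.
by rewrite (dsum (fun=> 1)); field.
Qed.

(** * Existence of the constrained minimum *)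

Lemma continuous_Qform i : continuous (Qform p k i).
Proof.
have cM (f g : 'rV[R]_n -> R) :
    continuous f -> continuous g -> continuous (fun t => f t * g t).
  by move=> cf cg t; apply: continuousM; [exact: cf|exact: cg].
have cC (c : R) : continuous (fun _ : 'rV[R]_n => c) by exact: cst_continuous.
have csqr (f : 'rV[R]_n -> R) : continuous f -> continuous (fun t => f t ^+ 2).
  by move=> cf; under eq_fun do rewrite expr2; exact: cM.
have cj j : continuous (fun t : 'rV[R]_n => t 0 j) by exact: coord_continuous.
have cQ1 : continuous (fun t : 'rV[R]_n => 2 * (\sum_(j | j != i)
    \sum_(K : {set 'I_n} | [&& #|K| == p.-1, i \notin K & j \notin K])
      (t 0 j) ^+ 2 / (lam k (i |: K)%SET * lam k (j |: K)%SET))).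
  apply: (cM) => //; apply: continuous_sum => j _; apply: continuous_sum => K _.
  by apply: (cM) => //; exact: csqr.
have cQ2 : continuous (fun t : 'rV[R]_n => \sum_(I : {set 'I_n} | #|I| == p)
    (lam k I) ^- 2 * (\sum_(j in I) t 0 j) ^+ 2).
  apply: continuous_sum => I _; apply: (cM) => //.
  by apply: csqr; exact: continuous_sum.
by move=> t; apply: (continuousD (cQ1 t) (cQ2 t)).
Qed.

Lemma closed_feasible : closed (feasible p k).
Proof.
have -> : feasible p k
    = (fun t : 'rV[R]_n => \sum_j t 0 j) @^-1` [set x | x = 1]
    `&` (fun t : 'rV[R]_n => \sum_j Scoef p k j * t 0 j) @^-1` [set x | x = 0].
  by [].
apply: closedI; apply: preimage_closed (@closed_eq R _) => t _.
  by apply: continuous_sum => j _; exact: coord_continuous.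
apply: continuous_sum => j _ u; apply: continuousM; first exact: cst_continuous.
exact: coord_continuous.
Qed.

(** A feasible sublevel set lies in a compact box, so the extreme value theorem applies. *)
Lemma minQ_attained i : ~ umbilic k ->
  exists t, [/\ feasible p k t, minQ p k i = Qform p k i t &
    forall t', feasible p k t' -> Qform p k i t <= Qform p k i t'].
Proof.
move=> /feasible_nonempty[t0 ft0].
(* A bound t_j^2 <= q / w gives |t_j| <= 1 + q / w; [B] also bounds t_i, which is 1 minus the other
   coordinates. *)
pose q := Qform p k i t0; pose r j := 1 + q / pair_weight i j.
pose B := 1 + \sum_(j | j != i) r j.
pose box : set 'rV[R]_n := [set t | forall j, `[(- B), B]%classic (t ord0 j)].
have cbox : compact box.
  by apply: (@rV_compact R n (fun=> `[(- B), B]%classic)) => j;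
    exact: segment_compact.
have sub t : feasible p k t -> Qform p k i t <= q -> box t.
  move=> [t1 _] tq.
  have tr j : j != i -> `|t 0 j| <= r j.
    move=> ji; have w0 := pair_weight_gt0 ji.
    have : t 0 j ^+ 2 <= q / pair_weight i j.
      rewrite ler_pdivlMr //; apply: le_trans tq.
      apply: le_trans (Qform_ge_weight t ji).
      by rewrite mulrC; have := mulr_ge0 (ltW w0) (sqr_ge0 (t 0 j)); lra.
    rewrite /r -real_normK ?num_real // => h.
    by have := sqr_ge0 (`|t 0 j| - 1); nra.
  have r0 j : j != i -> 0 <= r j by move=> /tr; apply: le_trans.
  move=> j /=; rewrite in_itv /= -ler_norml; have [->|ji] := eqVneq j i.
    have -> : t 0 i = 1 - \sum_(l | l != i) t 0 l.
      by rewrite -t1 (bigD1 i) //= addrK.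
    apply: le_trans (ler_normB _ _) _; rewrite normr1 lerD2l.
    by apply: le_trans (ler_norm_sum _ _ _) _; exact: ler_sum.
  apply: le_trans (tr _ ji) _; rewrite /B (bigD1 j) //=.
  rewrite addrCA lerDl addr_ge0 // sumr_ge0 // => l /andP[li _]; exact: r0.
have [t] := @EVT_min_rV R n (Qform p k i) (box `&` feasible p k)
  (ex_intro _ t0 (conj (sub t0 ft0 (lexx _)) ft0))
  (compact_closedI cbox closed_feasible)
  (continuous_subspaceT (@continuous_Qform i)).
rewrite inE => -[_ ft] mt.
have le_t t' : feasible p k t' -> Qform p k i t <= Qform p k i t'.
  move=> ft'; have [h|/ltW h] := leP (Qform p k i t') q.
    by apply: mt; rewrite inE; split=> //; exact: sub.
  by apply: le_trans h; apply: mt; rewrite inE; split=> //; exact: sub.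
(* A least element is unique, so [xget] returns this value and not its default 0. *)
exists t; split=> //; rewrite /minQ /minimum; apply: xget_unique.
  by split; [exists t|move=> _ [t' ft' <-]; exact: le_t].
move=> y [[t' ft' <-] lt']; apply/le_anti/andP; split; last exact: le_t.
by apply: lt'; exists t.
Qed.

End Cone.

(** * Sharpness of the constant 2/p *)

(* As e tends to 0, kappa approaches a boundary point of the cone at which all
   lam_I with i in I vanish; t_i is fixed by the constraint. *)
Lemma near_optimal (i : 'I_n) (e : R) : (1 < p)%N -> 0 < e -> e <= 1 ->
  exists k t : 'rV[R]_n,
    [/\ cone p k, ~ umbilic k, feasible p k t &
      meanH k * Qform p k i t / Scoef p k i
      = (1 + e / (n - p)%:R) * (2 * p%:R + e * n%:R) / (p%:R - e) ^+ 2].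
Proof.
move=> p1 e0 e1.
have M0 : 0 < 'C(n.-1, p.-1)%:R :> R by exact: bin_gt0R.
set M : R := 'C(n.-1, p.-1)%:R in M0.
have p2 : 2 <= p%:R :> R by rewrite ler_nat.
have q0 : 0 < (n - p)%:R :> R by rewrite ltr0n subn_gt0.
have nq : n%:R = (n - p)%:R + p%:R :> R by rewrite -natrD subnK // ltnW.
have n1 : n.-1%:R = n%:R - 1 :> R by rewrite -subn1 natrB // (leq_trans _ pn).
have pm1 : p.-1%:R = p%:R - 1 :> R by rewrite -subn1 natrB.
set q : R := (n - p)%:R in q0 nq *.
(* Solves (1 - q tau) / e + q tau / p = 0, which is the constraint divided by [M]. *)
pose tau : R := p%:R / ((p%:R - e) * q).
pose vec (a b : R) : 'rV[R]_n := \row_j (if j == i then a else b).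
have vec_sum a b (A : {set 'I_n}) : \sum_(j in A) vec a b 0 j =
    if i \in A then a + (#|A|.-1)%:R * b else #|A|%:R * b.
  have off (A' : {set 'I_n}) : i \notin A' ->
      \sum_(j in A') vec a b 0 j = #|A'|%:R * b.
    move=> iA; rewrite (eq_bigr (fun=> b)) ?sumr_const ?mulr_natl // => j jA.
    by rewrite mxE; case: eqP jA iA => // -> ->.
  case: ifPn => iA; last exact: off.
  rewrite (big_setD1 i) //= mxE eqxx off ?inE ?eqxx //.
  by rewrite (cardsD1 i A) iA.
have vec_sumT a b : \sum_j vec a b 0 j = a + (n%:R - 1) * b.
  have := vec_sum a b [set: 'I_n]%SET; rewrite inE cardsT card_ord n1 => <-.
  by apply: eq_bigl => j; rewrite inE.
pose k := vec (e - (p%:R - 1)) 1; pose t := vec (1 - (n%:R - 1) * tau) tau.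
have lamE (I : {set 'I_n}) : #|I| == p ->
    lam k I = if i \in I then e else p%:R.
  move=> /eqP cI; rewrite /lam vec_sum cI pm1.
  by case: ifP => _; ring.
have tE (I : {set 'I_n}) : #|I| == p ->
    \sum_(j in I) t 0 j = if i \in I then 1 - q * tau else p%:R * tau.
  move=> /eqP cI; rewrite vec_sum cI pm1 nq.
  by case: ifP => _; ring.
have sM : \sum_(I : {set 'I_n} | (#|I| == p) && (i \in I)) 1 = M.
  exact: sum_draws_in.
(* The total count n M / p minus the [M] subsets containing [i]. *)
have D : \sum_(I : {set 'I_n} | (#|I| == p) && (i \notin I)) 1
    = q * M / p%:R :> R.
  have := sum_draws; rewrite (bigID (fun I : {set 'I_n} => i \in I)) /=.
  rewrite sum_draws_in // -/M nq => h.
  apply: (mulfI (x := p%:R)); first by rewrite gt_eqF //; lra.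
  rewrite mulrCA mulfV ?mulr1; last by rewrite gt_eqF //; lra.
  by lra.
have split_sum (f : {set 'I_n} -> R) (a b : R) :
    (forall I : {set 'I_n}, #|I| == p -> f I = if i \in I then a else b) ->
    \sum_(I : {set 'I_n} | #|I| == p) f I = M * a + q * M / p%:R * b.
  move=> fE; rewrite (bigID (fun I : {set 'I_n} => i \in I)) /=.
  rewrite -D -sM !mulr_suml; congr (_ + _);
    apply: eq_bigr => I /andP[cI iI]; rewrite fE // mul1r.
    by rewrite iI.
  by rewrite (negPf iI).
have ck : cone p k.
  by move=> I /eqP /lamE ->; case: ifP => _ //; lra.
have sE : Scoef p k i = M / e.
  rewrite /Scoef -sM mulr_suml; apply: eq_bigr => I /andP[cI iI].
  by rewrite lamE // iI mul1r.
have HE : meanH k = q + e by rewrite /meanH vec_sumT nq; ring.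
have pe : 0 < p%:R - e by lra.
exists k, t; split => //.
(* Equal coordinates would force e - (p-1) = 1, impossible since e <= 1 < p. *)
- case=> c _ kc.
  have := congr1 (fun v : 'rV[R]_n => v 0 i) kc; rewrite /k !mxE eqxx => c1.
  have : \sum_j k 0 j = n%:R * c.
    rewrite -kc (eq_bigr (fun=> c)) ?sumr_const ?card_ord ?mulr_natl // => j _.
    by rewrite mxE.
  rewrite vec_sumT c1 => h.
  have : (n%:R - 1) * (p%:R - e) = 0 by lra.
  have : 0 < (n%:R - 1) * (p%:R - e) by rewrite mulr_gt0 //; lra.
  by move=> + h2; rewrite h2 ltxx.
- split; first by rewrite vec_sumT; ring.
  rewrite sum_Scoef (split_sum _ ((1 - q * tau) / e) tau).
    by rewrite /tau; field; rewrite !gt_eqF //; lra.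
  by move=> I cI; rewrite tE // lamE //; case: ifP => // _; field;
    rewrite gt_eqF //; lra.
- rewrite QformE // (split_sum _ (((1 - q * tau) / e) ^+ 2) (tau ^+ 2));
    last first.
    by move=> I cI; rewrite tE // lamE //; case: ifP => // _; field;
      rewrite gt_eqF //; lra.
  (* Here lam_I is [e], while the swapped subset avoids [i] and has lam equal to p. *)
  have -> : \sum_(I : {set 'I_n} | (#|I| == p) && (i \in I))
      \sum_(j | j \notin I) t 0 j ^+ 2 / (lam k I * lam k (j |: (I :\ i))%SET)
      = M * (q * (tau ^+ 2 / (e * p%:R))).
    rewrite -sM mulr_suml; apply: eq_bigr => I /andP[cI iI].
    have cC : #|~: I|%SET = (n - p)%N.
      by rewrite cardsCs finset.setCK card_ord (eqP cI).
    rewrite mul1r; transitivity (\sum_(j in ~: I) tau ^+ 2 / (e * p%:R));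
      last first.
      by rewrite sumr_const cC /q mulr_natl.
    apply: eq_big => [j|j jI]; first by rewrite inE.
    have ji : j != i by apply: contraNneq jI => ->.
    rewrite mxE (negPf ji) lamE // iI lamE.
      by rewrite !inE eqxx eq_sym (negPf ji).
    rewrite cardsU1 !inE (negPf jI) andbF /=.
    by rewrite -(eqP cI) (cardsD1 i I) iI.
  rewrite sE HE nq /tau; field; rewrite !gt_eqF //; lra.
Qed.

(** The value in [near_optimal] tends to 2/p as e tends to 0; an explicit e replaces the limit. *)
Lemma near_optimal_lt (i : 'I_n) (c : R) : (1 < p)%N -> 2 / p%:R < c ->
  exists k t : 'rV[R]_n,
    [/\ cone p k, ~ umbilic k, feasible p k t &
      meanH k * Qform p k i t / Scoef p k i < c].
Proof.
move=> p1 pc.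
have p2 : 2 <= p%:R :> R by rewrite ler_nat.
have q1 : 1 <= (n - p)%:R :> R by rewrite ler1n subn_gt0.
have n0 : 0 <= n%:R :> R by [].
set N := n%:R in n0; set q := (n - p)%:R in q1.
pose d := c - 2 / p%:R; have d0 : 0 < d by rewrite subr_gt0.
(* The numerator will exceed 2p by at most e (14 p + 8 N), which is below e (8 + 8 N) p^2, hence
   below d p^2. *)
pose e := Num.min 1 (d / (8 + 8 * N)).
have N8 : 0 < 8 + 8 * N by lra.
have e0 : 0 < e by rewrite lt_min ltr01 divr_gt0.
have e1 : e <= 1 by rewrite ge_min lexx.
have ed : e * (8 + 8 * N) <= d by rewrite -ler_pdivlMr // ge_min lexx orbT.
have [k [t [ck nu ft QE]]] := near_optimal i p1 e0 e1.
exists k, t; split => //; rewrite QE -/q -/N.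
have pe : 0 < p%:R - e by lra.
rewrite ltr_pdivrMr ?exprn_gt0 //.
(* Trades the denominator (p - e)^2 for p^2 at the cost of a factor (1 + e)^2. *)
have pe1 : p%:R <= (1 + e) * (p%:R - e) by nra.
have eq : e / q <= e by rewrite ler_pdivrMr; [nra|lra].
have cE : c * p%:R ^+ 2 = 2 * p%:R + d * p%:R ^+ 2.
  by rewrite /d; field; rewrite gt_eqF //; lra.
have c0 : 0 < c by apply: lt_trans pc; rewrite divr_gt0 //; lra.
have num : (1 + e / q) * (2 * p%:R + e * N) <= (1 + e) * (2 * p%:R + e * N).
  by apply: ler_wpM2r; [nra|lra].
have e2 : e ^+ 2 <= e by rewrite expr2 ger_pMl.
have e3 : e ^+ 3 <= e by rewrite exprS ger_pMr // (le_trans e2).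
have cube : (1 + e) ^+ 3 <= 1 + 7 * e by lra.
have step : (1 + e) ^+ 3 * (2 * p%:R + e * N) < c * p%:R ^+ 2.
  apply: le_lt_trans (_ : (1 + 7 * e) * (2 * p%:R + e * N) < _).
    by apply: ler_wpM2r => //; nra.
  rewrite cE; have : e * (8 + 8 * N) * p%:R ^+ 2 <= d * p%:R ^+ 2.
    by apply: ler_wpM2r => //; exact: sqr_ge0.
  set X := p%:R ^+ 2; move=> dX.
  have pX : 2 * p%:R <= X by rewrite /X expr2 ler_wpM2r //; lra.
  have NX : 0 <= N * (X - 4) by rewrite mulr_ge0 //; lra.
  have eX : 0 < e * ((8 + 8 * N) * X - 8 * N - 14 * p%:R).
    by rewrite mulr_gt0 //; lra.
  have eN : e ^+ 2 * N <= e * N by apply: ler_wpM2r.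
  lra.
apply: le_lt_trans num _.
have e1_2 : 0 < (1 + e) ^+ 2 by rewrite exprn_gt0 //; lra.
rewrite -(ltr_pM2l e1_2).
have -> : (1 + e) ^+ 2 * ((1 + e) * (2 * p%:R + e * N))
          = (1 + e) ^+ 3 * (2 * p%:R + e * N) by ring.
apply: lt_le_trans step _; rewrite [leRHS]mulrCA ler_pM2l // -exprMn.
by rewrite ler_sqr ?nnegrE //; nra.
Qed.

End Estimates.

Theorem proposition4p3 (R : realType) (n p : nat)
    (hn : (3 <= n)%N) (hp2 : (2 <= p)%N) (hpn : (p <= n.-1)%N) :
  [/\ forall (kappa : 'rV[R]_n) (i : 'I_n) (t : 'rV[R]_n),
        cone p kappa ->
        \sum_j Scoef p kappa j * t 0 j = 0 ->
        2 * Scoef p kappa i / (p%:R * meanH kappa) * (\sum_j t 0 j) ^+ 2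
          <= Qform p kappa i t,
      forall (kappa : 'rV[R]_n) (i : 'I_n) (t : 'rV[R]_n),
        cone p kappa ->
        \sum_j Scoef p kappa j * t 0 j = 0 ->
        Qform p kappa i t =
          2 * Scoef p kappa i / (p%:R * meanH kappa) * (\sum_j t 0 j) ^+ 2 ->
        t = 0,
      forall (kappa : 'rV[R]_n) (i : 'I_n),
        (cone p `\` umbilic) kappa ->
        2 / p%:R < meanH kappa * minQ p kappa i / Scoef p kappa i,
      forall i : 'I_n,
        inf [set meanH kappa * minQ p kappa i / Scoef p kappa i
              | kappa in cone p `\` umbilic] = 2 / p%:R :> R
    & forall (i : 'I_n) (c : R), 2 / p%:R < c ->
        ~ (forall kappa t : 'rV[R]_n,
             cone p kappa ->
             \sum_j Scoef p kappa j * t 0 j = 0 ->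
             c * Scoef p kappa i / meanH kappa * (\sum_j t 0 j) ^+ 2
               <= Qform p kappa i t)].
Proof.
have p0 : (0 < p)%N by exact: ltnW.
have pn : (p < n)%N by case: n hn hpn.
have n0 : 0 < n%:R :> R by rewrite ltr0n (leq_trans _ pn).
have pR : 0 < p%:R :> R by rewrite ltr0n.
have gap0 (kappa : 'rV[R]_n) : cone p kappa ->
    0 < 4 * 'C(n.-1, p.-1)%:R / (n%:R * p%:R * meanH kappa ^+ 2).
  move=> ck; have H0 := meanH_gt0 p0 pn ck.
  by rewrite divr_gt0 // !mulr_gt0 ?bin_gt0R.
have minQ_gt (kappa : 'rV[R]_n) i : (cone p `\` umbilic) kappa ->
    2 / p%:R < meanH kappa * minQ p kappa i / Scoef p kappa i.
  move=> [ck nu]; have [t [[t1 tS] -> _]] := minQ_attained p0 pn ck i nu.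
  have := Qform_lower p0 pn ck i hp2 tS; rewrite t1 expr1n !mulr1 => low.
  have H0 := meanH_gt0 p0 pn ck; have S0 := Scoef_gt0 p0 pn ck i.
  rewrite ltr_pdivlMr // -ltr_pdivrMl //; apply: lt_le_trans low.
  have -> : (meanH kappa)^-1 * (2 / p%:R * Scoef p kappa i)
            = 2 * Scoef p kappa i / (p%:R * meanH kappa).
    by field; rewrite !gt_eqF.
  by rewrite ltrDl gap0.
have minQ_le (kappa : 'rV[R]_n) i t :
    cone p kappa -> ~ umbilic kappa -> feasible p kappa t ->
    meanH kappa * minQ p kappa i / Scoef p kappa i
    <= meanH kappa * Qform p kappa i t / Scoef p kappa i.
  move=> ck nu ft; have [t0 [_ -> t0_min]] := minQ_attained p0 pn ck i nu.
  have H0 := meanH_gt0 p0 pn ck; have S0 := Scoef_gt0 p0 pn ck i.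
  by rewrite ler_pM2r ?invr_gt0 // ler_pM2l // t0_min.
split.
- move=> kappa i t ck tS; apply: le_trans (Qform_lower p0 pn ck i hp2 tS).
  by rewrite lerDl mulr_ge0 ?sqr_ge0 // ltW // gap0.
- move=> kappa i t ck tS Qt; have := Qform_lower p0 pn ck i hp2 tS.
  (* Equality makes the surplus nonpositive, so T = 0; then Q_i = 0 and [Qform_le0] applies. *)
  rewrite Qt gerDl pmulr_rle0 ?gap0 // real_exprn_even_le0 ?num_real //=.
  move=> /eqP T0.
  by apply: (Qform_le0 p0 pn ck (i := i)) => //; rewrite Qt T0 expr0n mulr0.
- by [].
- move=> i; apply/le_anti/andP; split.
    apply/ler_addgt0Pr => e e0.
    have [|k [t [ck nu ft lt]]] :=
      near_optimal_lt (R := R) p0 pn i (c := 2 / p%:R + e) hp2.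
      by rewrite ltrDl.
    apply: le_trans (ltW lt); apply: le_trans (minQ_le _ i _ ck nu ft).
    apply: ge_inf; last by exists k.
    by exists (2 / p%:R) => _ [k' ck' <-]; exact/ltW/minQ_gt.
  (* The margin 1 is arbitrary: only a point of the set is wanted, as [lb_le_inf] needs
     nonemptiness. *)
  have [|k [t [ck nu ft _]]] :=
    near_optimal_lt (R := R) p0 pn i (c := 2 / p%:R + 1) hp2.
    by rewrite ltrDl.
  apply: lb_le_inf; first by exists (meanH k * minQ p k i / Scoef p k i), k.
  by move=> _ [k' ck' <-]; exact/ltW/minQ_gt.
- move=> i c pc ineq.
  have [k [t [ck nu [t1 tS] lt]]] := near_optimal_lt p0 pn i hp2 pc.
  (* The near-optimal [t] has sum 1, so the assumed inequality reads c S_i / H <= Q_i, against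
     [lt]. *)
  have := ineq k t ck tS; rewrite t1 expr1n mulr1 => le.
  have H0 := meanH_gt0 p0 pn ck; have S0 := Scoef_gt0 p0 pn ck i.
  move: lt; rewrite ltr_pdivrMr // -[ltRHS]mulr1 mulrC -ltr_pdivlMr //.
  by rewrite mulr1 ltNge le.
Qed.
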